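(* Let $H$ be a separable complex Hilbert space. Let $B$ be an unbounded closed linear operator in $H$ and let $A$ be a bounded linear operator on $H$ such that $AB$ and $A$ are normal. Then \[BA \text{ normal } \Longrightarrow A^*AB\subset BA^*A.\] If further $BA$ is hyponormal (respectively, subnormal), then \[A^*AB\subset BA^*A \Longrightarrow BA \text{ normal}.\]
   Context: An unbounded operator $T$ in $H$ is a linear operator defined on a linear subspace $D(T)\subset H$ (its domain); bounded operators are defined on all of $H$. Products have their natural domains: $D(ST)=\{x\in D(T): Tx\in D(S)\}$; in particular $D(AB)=D(B)$ and $D(BA)=\{x\in H: Ax\in D(B)\}$. For operators $S,T$, the inclusion $S\subset T$ means that $D(S)\subset D(T)$ and $Sx=Tx$ for all $x\in D(S)$. An operator is closed if its graph is closed in $H\times H$. $T^*$ denotes the Hilbert space adjoint of a densely defined operator $T$. A densely defined operator $T$ is normal if it is closed and $TT^*=T^*T$ (equality of operators including domains). A densely defined operator $T$ is hyponormal if $D(T)\subset D(T^* )$ and $\|T^*x\|\leq\|Tx\|$ for all $x\in D(T)$. A densely defined operator $T$ in $H$ is subnormal if there are a Hilbert space $K$ containing $H$ as a closed subspace and a normal operator $N$ in $K$ such that $D(T)\subset D(N)$ and $Tx=Nx$ for all $x\in D(T)$. *)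

(* Defs.v *)
From HB Require Import structures.
From mathcomp Require Import all_boot all_order all_algebra.
From mathcomp Require Import complex.
From mathcomp Require Import all_classical all_reals all_analysis.

Set Implicit Arguments.
Unset Strict Implicit.
Unset Printing Implicit Defensive.

Import Order.TTheory GRing.Theory Num.Theory.
Import numFieldNormedType.Exports.

Local Open Scope classical_set_scope.
Local Open Scope ring_scope.

(* The inner product is linear in its first argument and conjugate-linear in
   its second one.  For C := R[i] with R : realType, hilbertType C is the type
   of complex Hilbert spaces (no separability is built in). *)
HB.mixin Record NormedModule_isHilbert (C : numClosedFieldType) H
    of NormedModule C H := {
  inner : {dot H for Num.conj} ;
  normr_inner : forall x : H, `|x| ^+ 2 = inner x x }.

#[short(type="hilbertType")]
HB.structure Definition Hilbert (C : numClosedFieldType) :=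
  {H of NormedModule_isHilbert C H & CompleteNormedModule C H}.

Definition separable (T : topologicalType) :=
  exists2 S : set T, countable S & dense S.

Definition linear_subspace (C : numClosedFieldType) (H : hilbertType C)
    (D : set H) :=
  D 0 /\ forall (a : C) (x y : H), D x -> D y -> D (a *: x + y).

(* The values of [opfun] outside [opdom] carry no meaning. *)
Record operator (C : numClosedFieldType) (H : hilbertType C) := Operator {
  opdom : set H ;
  opfun :> H -> H ;
  opdom_subspace : linear_subspace opdom ;
  op_linear : forall (a : C) (x y : H), opdom x -> opdom y ->
    opfun (a *: x + y) = a *: opfun x + opfun y }.

Section Operators.
Context (C : numClosedFieldType) (H : hilbertType C).
Implicit Types S T : operator H.

Definition op_sub S T :=
  opdom S `<=` opdom T /\ forall x, opdom S x -> S x = T x.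

(* Leibniz equality is not used since it would also compare the values
   outside the domains. *)
Definition op_eq S T := op_sub S T /\ op_sub T S.

Definition densely_defined T := dense (opdom T).

Definition closed_op T :=
  closed [set p : H * H | opdom T p.1 /\ p.2 = T p.1].

Definition bounded_op T :=
  opdom T = setT /\ exists M : C, forall x : H, `|T x| <= M * `|x|.

Lemma op0 T : T 0 = 0.
Proof.
have [D0 _] := opdom_subspace T.
have := op_linear (-1) D0 D0.
by rewrite scaler0 addr0 scaleN1r addNr.
Qed.

Definition opcomp_dom S T : set H := [set x | opdom T x /\ opdom S (T x)].

Lemma opcomp_subspace S T : linear_subspace (opcomp_dom S T).
Proof.
have [S0 SP] := opdom_subspace S; have [T0 TP] := opdom_subspace T.
split=> [|a x y [Tx Sx] [Ty Sy]]; first by split=> //; rewrite op0.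
by split; [exact: TP|rewrite op_linear//; exact: SP].
Qed.

Lemma opcomp_linear S T (a : C) (x y : H) :
  opcomp_dom S T x -> opcomp_dom S T y ->
  S (T (a *: x + y)) = a *: S (T x) + S (T y).
Proof. by move=> [Tx Sx] [Ty Sy]; rewrite !op_linear. Qed.

Definition opcomp S T : operator H :=
  Operator (opcomp_subspace S T) (@opcomp_linear S T).

Definition adjoint_rel T (y z : H) :=
  forall x, opdom T x -> inner (T x) y = inner x z.

Definition adjoint_dom T : set H := [set y | exists z, adjoint_rel T y z].

Definition adjoint_fun T (y : H) : H := xget 0 [set z | adjoint_rel T y z].

Lemma adjoint_relD T (a : C) (y1 y2 z1 z2 : H) :
  adjoint_rel T y1 z1 -> adjoint_rel T y2 z2 ->
  adjoint_rel T (a *: y1 + y2) (a *: z1 + z2).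
Proof. by move=> h1 h2 x Tx; rewrite [LHS]linearPr [RHS]linearPr /= h1 ?h2. Qed.

Lemma adjoint_subspace T : linear_subspace (adjoint_dom T).
Proof.
split=> [|a x y [z xz] [w yw]]; first by exists 0 => x Tx; rewrite !linear0.
by exists (a *: z + w); exact: adjoint_relD.
Qed.

Lemma dense_orthogonal (D : set H) (z : H) : dense D ->
  (forall x, D x -> inner x z = 0) -> z = 0.
Proof.
move=> Dd Dz; apply/eqP; apply: contraT => z0.
have /Dd : ball z `|z| !=set0 by exists z; apply: ballxx; rewrite normr_gt0.
case; first by apply: (@ball_open C H); rewrite normr_gt0.
move=> x [zx Dx]; move: zx; rewrite -ball_normE /ball_ /=.
rewrite -(@ltr_pXn2r _ 2)// ?nnegrE// !normr_inner.
rewrite linearBl/= !linearBr/= (Dz x Dx).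
have -> : inner z x = 0 by rewrite hermC /= Dz// conjC0 mulr0.
rewrite subr0 sub0r opprK -normr_inner -(normr_inner x) gtrDl.
by move=> /(le_lt_trans (exprn_ge0 2 (normr_ge0 x))); rewrite ltxx.
Qed.

Lemma adjoint_rel_uniq T (y z1 z2 : H) : densely_defined T ->
  adjoint_rel T y z1 -> adjoint_rel T y z2 -> z1 = z2.
Proof.
move=> dT h1 h2; apply/eqP; rewrite -subr_eq0; apply/eqP.
apply: (dense_orthogonal dT) => x Tx.
by rewrite linearBr/= -h1// -h2// subrr.
Qed.

Lemma adjoint_funP T (y : H) : adjoint_dom T y ->
  adjoint_rel T y (adjoint_fun T y).
Proof. exact: xgetPex. Qed.

Lemma adjoint_linear T : densely_defined T ->
  forall (a : C) (x y : H), adjoint_dom T x -> adjoint_dom T y ->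
  adjoint_fun T (a *: x + y) = a *: adjoint_fun T x + adjoint_fun T y.
Proof.
move=> dT a x y Tx Ty; apply: (adjoint_rel_uniq dT).
- by apply: adjoint_funP; exact: (adjoint_subspace T).2.
- by apply: adjoint_relD; exact: adjoint_funP.
Qed.

Definition adjoint T (dT : densely_defined T) : operator H :=
  Operator (adjoint_subspace T) (adjoint_linear dT).

Definition normal_op T := exists dT : densely_defined T,
  closed_op T /\ op_eq (opcomp T (adjoint dT)) (opcomp (adjoint dT) T).

Definition hyponormal_op T := exists dT : densely_defined T,
  opdom T `<=` opdom (adjoint dT) /\
  forall x, opdom T x -> `|adjoint dT x| <= `|T x|.

Lemma bounded_densely_defined T : bounded_op T -> densely_defined T.
Proof. by move=> [TT _] O [x Ox] _; exists x; rewrite TT. Qed.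

End Operators.

(* K contains H as a closed subspace: via a linear map J : H -> K preserving
   the inner product, with closed range. *)
Definition subnormal_op (C : numClosedFieldType) (H : hilbertType C)
    (T : operator H) :=
  densely_defined T /\
  exists (K : hilbertType C) (J : {linear H -> K}) (N : operator K),
    [/\ (forall x y : H, inner (J x) (J y) = inner x y),
        closed (range J),
        normal_op N &
        forall x, opdom T x -> opdom N (J x) /\ J (T x) = N (J x)].

(* Main.v *)
Require Import Defs.
From HB Require Import structures.
From mathcomp Require Import all_boot all_order all_algebra.
From mathcomp Require Import complex.
From mathcomp Require Import all_classical all_reals all_analysis.
From mathcomp Require Import ring lra zify.

(** Put T = BA and M = AB, so that A T x = M A x on D(T).

    If T is normal, the Fuglede-Putnam theorem for the unbounded normal
    operators T and M gives A T^* <= M^* A (inclusion of operators), and taking adjoints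
    A^* M <= T A^*.
    The theorem is proved without spectral theory: for t > 0 put
    E = (1 + t T^*T)^-1 and F = (1 + t M^*M)^-1.  For |mu| = sqrt t the operator
    (F + mu M^*F)^n A (E - mu T^*E)^n E^n is bounded by the norm of A, because
    the intertwining relation and normality turn it into
    F^n A ((E - a TE)(E + a TE))^n with a the conjugate of mu.  The Cauchy
    estimate for its coefficient of mu bounds
    M^* F^n A E^2n - F^n A E^2n T^* by |A| / (n sqrt t); now let t tend to 0
    with n sqrt t -> oo and n t -> 0, so that E^2n and F^n tend to 1 strongly.

    Conversely, A^* M <= T A^* implies A T^* <= M^* A.  Hence A sends both
    u = (1 + T^*T)^-1 h and u' = (1 + TT^* )^-1 h to (1 + M^*M)^-1 A h, and
    u - u' = TT^*u' - T^*Tu lies in ker A as well as in its orthogonal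
    complement, provided that ker A is contained in ker T^*, which is all that
    hyponormality or subnormality of T is used for.  So u = u' for all h, that
    is, TT^* = T^*T. *)

Set Implicit Arguments.
Unset Strict Implicit.
Unset Printing Implicit Defensive.

Import Order.TTheory GRing.Theory Num.Theory.
Import numFieldNormedType.Exports.

Local Open Scope classical_set_scope.
Local Open Scope ring_scope.

(** * Inner products *)

Section InnerProduct.
Context (C : numClosedFieldType) (H : hilbertType C).
Implicit Types x y z u v : H.

Lemma innerC x y : inner x y = (inner y x)^*.
Proof. by rewrite hermC expr0 mul1r. Qed.

Lemma innerDl x y z : inner (x + y) z = inner x z + inner y z.
Proof. by rewrite linearDl. Qed.

Lemma innerDr z x y : inner z (x + y) = inner z x + inner z y.
Proof. by rewrite linearDr. Qed.

Lemma innerNl x z : inner (- x) z = - inner x z.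
Proof. by rewrite linearNl. Qed.

Lemma innerNr z x : inner z (- x) = - inner z x.
Proof. by rewrite linearNr. Qed.

Lemma innerBl x y z : inner (x - y) z = inner x z - inner y z.
Proof. by rewrite linearBl. Qed.

Lemma innerBr z x y : inner z (x - y) = inner z x - inner z y.
Proof. by rewrite linearBr. Qed.

Lemma innerZl (a : C) x z : inner (a *: x) z = a * inner x z.
Proof. by rewrite linearZl_LR. Qed.

Lemma innerZr (a : C) z x : inner z (a *: x) = a^* * inner z x.
Proof. by rewrite linearZr_LR. Qed.

Lemma inner0l z : inner 0 z = 0.
Proof. by rewrite linear0l. Qed.

Lemma inner0r z : inner z 0 = 0.
Proof. by rewrite linear0r. Qed.

Lemma inner_eq0 x : inner x x = 0 -> x = 0.
Proof. by rewrite -normr_inner => /eqP; rewrite sqrf_eq0 normr_eq0 => /eqP. Qed.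

Lemma inner_inj x y : (forall z, inner x z = inner y z) -> x = y.
Proof.
move=> xy; apply/eqP; rewrite -subr_eq0; apply/eqP; apply: inner_eq0.
by rewrite innerBl xy subrr.
Qed.

Lemma normrD2 x y :
  `|x + y| ^+ 2 = `|x| ^+ 2 + `|y| ^+ 2 + (inner x y + (inner x y)^*).
Proof. by rewrite !normr_inner dnormD. Qed.

Lemma normrB2 x y :
  `|x - y| ^+ 2 = `|x| ^+ 2 + `|y| ^+ 2 - (inner x y + (inner x y)^*).
Proof. by rewrite !normr_inner dnormB. Qed.

(** Cauchy-Schwarz: removing from [x] its projection on [y] leaves a vector of nonnegative squared
    norm. *)
Lemma inner_leM x y : `|inner x y| <= `|x| * `|y|.
Proof.
have [->|y0] := eqVneq y 0; first by rewrite inner0r !normr0 mulr0.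
have n0 : 0 < `|y| ^+ 2 by rewrite exprn_gt0// normr_gt0.
rewrite -(@ler_pXn2r _ 2)// ?nnegrE// ?mulr_ge0// exprMn -ler_pdivrMr//.
have := exprn_ge0 2 (normr_ge0 (x - (inner x y / `|y| ^+ 2) *: y)).
rewrite normrB2 innerZr normrZ exprMn normrM normfV exprMn exprVn.
rewrite rmorphM fmorphV (rmorphXn _ 2)/= !(CrealP (normr_real _)).
set a := inner x y; rewrite !(rmorphM, fmorphV, rmorphXn)/= conjCK.
rewrite (CrealP (normr_real _)) (ger0_norm (exprn_ge0 _ (normr_ge0 _))).
have -> : a^* / `|y| ^+ 2 * a + a / `|y| ^+ 2 * a^* = (`|a| ^+ 2 / `|y| ^+ 2) *+ 2.
  by rewrite normCK; field; rewrite gt_eqF// normr_gt0.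
have -> : `|a| ^+ 2 / (`|y| ^+ 2) ^+ 2 * `|y| ^+ 2 = `|a| ^+ 2 / `|y| ^+ 2.
  by field; rewrite gt_eqF// normr_gt0.
by rewrite mulr2n opprD addrA addrK subr_ge0.
Qed.

Lemma small_eq0 (z : C) : (forall e : C, 0 < e -> `|z| <= e) -> z = 0.
Proof.
move=> ze; apply/eqP; apply: contraT => z0.
have n0 : 0 < `|z| by rewrite normr_gt0.
have := ze _ (divr_gt0 n0 (ltr0n C 2)).
by rewrite ler_pdivlMr// mulr2n mulrDr mulr1 gerDl (lt_geF n0).
Qed.

End InnerProduct.

(* Everything is stated over an abstract [C], for which these two properties are
   assumed: over [R[i]] itself, unification unfolds the complex arithmetic. *)
Definition has_infima (C : numClosedFieldType) := forall S : set C, S !=set0 ->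
  (forall s, S s -> 0 <= s) ->
  exists d : C, (forall s, S s -> d <= s) /\
    forall e : C, 0 < e -> exists2 s, S s & s < d + e.

Definition archimedean_closed (C : numClosedFieldType) := forall e : C, 0 < e ->
  exists N, forall n, (N <= n)%N -> n.+1%:R^-1 < e.

(** * Infima and the Archimedean property for complex numbers *)

Section ComplexNumbers.
Local Open Scope complex_scope.

(** Elements above 0 in the partial order of [R[i]] are real, so the infimum is that of the real
    parts. *)
Lemma complex_has_infima (R : realType) : has_infima R[i].
Proof.
move=> S [s0 Ss0] S0.
have SR s : S s -> s = (complex.Re s)%:C.
  by move=> /S0 s0'; rewrite RRe_real// ger0_real.
pose S' := [set complex.Re s | s in S].
have iS' : has_inf S'.
  split; first by exists (complex.Re s0), s0.
  by exists 0 => _ [s Ss <-]; have := S0 _ Ss; rewrite (SR _ Ss) ler0c.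
exists (inf S')%:C; split=> [s Ss|e e0].
  rewrite (SR _ Ss) lecR; apply: ge_inf; last by exists s.
  by case: iS'.
have eR : e = (complex.Re e)%:C by rewrite RRe_real// gtr0_real.
have [|_ [s Ss <-] h] := inf_adherent (_ : 0 < complex.Re e) iS'.
  by move: e0; rewrite eR ltcR.
by exists s => //; rewrite (SR _ Ss) eR -rmorphD/= ltcR.
Qed.

Lemma complex_archimedean (R : realType) : archimedean_closed R[i].
Proof.
move=> e e0; have eR : e = (complex.Re e)%:C by rewrite RRe_real// gtr0_real.
have r0 : 0 < complex.Re e by move: e0; rewrite eR ltcR.
exists (Num.truncn (complex.Re e)^-1) => n Nn.
have -> : n.+1%:R^-1 = (n.+1%:R^-1 : R)%:C :> R[i] by rewrite fmorphV/= rmorph_nat.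
rewrite eR ltcR invf_plt ?posrE//.
apply: (lt_le_trans (truncnS_gt _)); by rewrite ler_nat ltnS.
Qed.

End ComplexNumbers.

(** * Closed operators *)

Section Closed.
Context (C : numClosedFieldType) (H : hilbertType C).
Implicit Types (T : operator H) (x y h k : H).

Lemma opZ T (a : C) x : opdom T x -> T (a *: x) = a *: T x.
Proof.
move=> Tx; have [T0 _] := opdom_subspace T.
by rewrite -[a *: x]addr0 op_linear// op0 addr0.
Qed.

Lemma opD T x y : opdom T x -> opdom T y -> T (x + y) = T x + T y.
Proof. by move=> Tx Ty; rewrite -[x]scale1r op_linear// !scale1r. Qed.

Lemma opB T x y : opdom T x -> opdom T y -> T (x - y) = T x - T y.
Proof. by move=> Tx Ty; rewrite addrC -scaleN1r op_linear// scaleN1r addrC. Qed.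

Lemma opdomP T (a : C) x y : opdom T x -> opdom T y -> opdom T (a *: x + y).
Proof. by move=> Tx Ty; apply: (opdom_subspace T).2. Qed.

Lemma opdom0 T : opdom T 0.
Proof. exact: (opdom_subspace T).1. Qed.

Lemma opdomZ T (a : C) x : opdom T x -> opdom T (a *: x).
Proof. by move=> Tx; rewrite -[_ *: _]addr0; exact: (opdomP _ _ (opdom0 T)). Qed.

Lemma opdomD T x y : opdom T x -> opdom T y -> opdom T (x + y).
Proof. by move=> Tx Ty; rewrite -[x]scale1r; exact: opdomP. Qed.

Lemma opdomB T x y : opdom T x -> opdom T y -> opdom T (x - y).
Proof. by move=> Tx Ty; rewrite addrC -scaleN1r; exact: opdomP. Qed.

Lemma closed_opP T : closed_op T <-> forall x y,
  (forall e : C, 0 < e -> exists u, [/\ opdom T u, `|x - u| < e & `|y - T u| < e]) ->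
  opdom T x /\ y = T x.
Proof.
split=> [cT x y xy|h].
  apply: (cT (x, y)) => B /nbhs_ballP[e /= e0 eB].
  have [u [Tu xu yu]] := xy _ e0; exists (u, T u); split=> //; apply: eB.
  by split; rewrite /= -ball_normE.
move=> [x y] cxy; apply: h => e e0.
have [[u v] [/= [Tu ->] [/= xu yu]]] :
    [set p : H * H | opdom T p.1 /\ p.2 = T p.1] `&` ball (x, y) e !=set0.
  by apply: cxy; exact: nbhsx_ballx.
by exists u; split=> //; [move: xu|move: yu]; rewrite -ball_normE.
Qed.

(** Closeness to the single term [u N] already makes the sequence Cauchy. *)
Lemma cauchy_limit (u : nat -> H) :
  (forall e : C, 0 < e -> exists N, forall n, (N <= n)%N -> `|u N - u n| < e) ->
  exists x, forall e : C, 0 < e -> exists N, forall n, (N <= n)%N -> `|x - u n| < e.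
Proof.
move=> uC; have : cauchy (u @ \oo).
  apply: cauchy_exP => e e0; have [N Nn] := uC _ e0; exists (u N), N => // n /= Nle.
  by rewrite -ball_normE /=; exact: Nn.
move=> /cauchy_cvgP/cvg_ex[x /cvgrPdist_lt ux]; exists x => e e0.
have [N _ Nn] := ux _ e0; exists N => n Nle; exact: Nn.
Qed.

(* Orthogonal projection of [(h, k)] onto the graph of [T], where the second
   factor of [H * H] carries the norm of [H] scaled by [sqrt t]. *)
Lemma graph_projection T (t : C) h k : has_infima C -> archimedean_closed C ->
  closed_op T -> 0 < t ->
  exists2 x, opdom T x &
    forall u, opdom T u -> inner (h - x) u + t * inner (k - T x) (T u) = 0.
Proof.
move=> infC archC /closed_opP cT t0.
(* Squared distance from [(h, k)] to the graph point over [x]; its infimum is [d]. *)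
pose q x := `|h - x| ^+ 2 + t * `|k - T x| ^+ 2.
have q0 x : 0 <= q x by rewrite addr_ge0 ?exprn_ge0 ?mulr_ge0 ?exprn_ge0// ltW.
have [|s [x _ <-]//|d [dq qd]] := infC [set q x | x in opdom T].
  by exists (q 0), 0 => //; exact: opdom0.
have {}dq x : opdom T x -> d <= q x by move=> Tx; apply: dq; exists x.
(* Parallelogram law: the midpoint of two almost minimal points costs at least [d], which forces
   them together. *)
have mini (e : C) x y : opdom T x -> opdom T y -> q x <= d + e -> q y <= d + e ->
    `|x - y| ^+ 2 + t * `|T x - T y| ^+ 2 <= 4 * e.
  move=> Tx Ty qx qy; have Tm := opdomZ 2^-1 (opdomD Tx Ty).
  have := dq _ Tm; rewrite /q opZ ?opD//; last exact: opdomD.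
  have para (a b c : H) :
      `|a - b| ^+ 2 = `|c - a| ^+ 2 *+ 2 + `|c - b| ^+ 2 *+ 2 - 4 * `|c - 2^-1 *: (a + b)| ^+ 2.
    have -> : a - b = (c - b) - (c - a) by rewrite opprB [RHS]addrC subrKA.
    have -> : c - 2^-1 *: (a + b) = 2^-1 *: ((c - b) + (c - a)).
      rewrite addrACA -opprD -mulr2n scalerBr -(scaler_nat 2 c) scalerA.
      by rewrite mulVf ?pnatr_eq0// scale1r [b + a]addrC.
    rewrite normrZ exprMn normfV normr_nat (normrB2 (c - b)) (normrD2 (c - b)).
    by field.
  rewrite (para x y h) (para (T x) (T y) k) => dm.
  move: qx qy dm; rewrite /q; set X := `|h - x| ^+ 2; set Y := `|h - y| ^+ 2.
  set X' := `|k - T x| ^+ 2; set Y' := `|k - T y| ^+ 2.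
  set M := `|h - _| ^+ 2; set M' := `|k - _| ^+ 2 => qx qy dm.
  rewrite -subr_ge0.
  have -> : 4 * e - (X *+ 2 + Y *+ 2 - 4 * M + t * (X' *+ 2 + Y' *+ 2 - 4 * M')) =
     ((d + e) - (X + t * X')) *+ 2 + ((d + e) - (Y + t * Y')) *+ 2 + ((M + t * M') - d) *+ 4.
    by ring.
  by apply: addr_ge0; [apply: addr_ge0|]; apply: mulrn_wge0; rewrite subr_ge0.
(* First variation: [x] is compared with [x + (L / Q) *: u], where [L] is the pairing to be bounded.
   The summand 1 keeps [Q] positive even for [u = 0]. *)
have var (e : C) x u : opdom T x -> opdom T u -> q x <= d + e ->
    `|inner (h - x) u + t * inner (k - T x) (T u)| ^+ 2 <=
    e * (`|u| ^+ 2 + t * `|T u| ^+ 2 + 1).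
  move=> Tx Tu qx; set L := inner _ _ + _; set Q := _ + _.
  have Q0 : 0 < Q.
    by rewrite ltr_wpDl// addr_ge0 ?exprn_ge0 ?mulr_ge0 ?exprn_ge0// ltW.
  have tr : t^* = t by apply/CrealP/gtr0_real.
  have Qr : Q^* = Q by apply/CrealP/gtr0_real.
  have := dq _ (opdomP (L / Q) Tu Tx); rewrite /q op_linear//.
  rewrite ![(L / Q) *: _ + _]addrC !opprD !addrA.
  rewrite (normrB2 (h - x)) (normrB2 (k - T x)) !innerZr !normrZ !exprMn !rmorphM !fmorphV/= Qr conjCK.
  have nLQ : `|L| ^+ 2 * `|Q^-1| ^+ 2 = L * L^* / Q ^+ 2.
    by rewrite normfV normCK (gtr0_norm Q0) exprVn.
  rewrite nLQ Qr [`|L| ^+ 2]normCK -subr_ge0.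
  have LE : L^* = (inner (h - x) u)^* + t * (inner (k - T x) (T u))^*.
    by rewrite /L rmorphD rmorphM/= tr.
  move: LE; move: qx; rewrite /q; set a := `|h - x| ^+ 2; set b := `|k - T x| ^+ 2.
  set i1 := inner _ u; set i2 := inner _ (T u) => qx LE.
  rewrite -subr_ge0 in qx.
  move=> dm; rewrite -subr_ge0.
  have QE : `|u| ^+ 2 + t * `|T u| ^+ 2 = Q - 1 by rewrite /Q addrK.
  have L2 : 0 <= L * L^* by rewrite mul_conjC_ge0.
  have Qn : Q != 0 by rewrite gt_eqF.
  suff -> : e * Q - L * L^* = ((d + e - (a + t * b)) +
    (a + L * L^* / Q ^+ 2 * `|u| ^+ 2 - (L^* / Q * i1 + L / Q * i1^*) +
     t * (b + L * L^* / Q ^+ 2 * `|T u| ^+ 2 - (L^* / Q * i2 + L / Q * i2^*)) - d)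
      + L * L^* / Q ^+ 2) * Q.
    apply: mulr_ge0; last exact: ltW.
    apply: addr_ge0; first exact: addr_ge0.
    by rewrite divr_ge0// exprn_ge0// ltW.
  transitivity ((e + L * L^* / Q ^+ 2 * (`|u| ^+ 2 + t * `|T u| ^+ 2) + L * L^* / Q ^+ 2
     - (L^* / Q * (i1 + t * i2) + L / Q * (i1^* + t * i2^*))) * Q); last by field.
  by rewrite QE -LE -/L; field.
(* By [mini], a minimizing sequence and its image under [T] are both Cauchy; closedness puts their
   limit on the graph. *)
have /choice[x_ xP] n : exists x, opdom T x /\ q x < d + n.+1%:R^-1.
  by have [|_ [x Tx <-] qx] := qd n.+1%:R^-1; [rewrite invr_gt0|exists x].
have xd m n : (m <= n)%N ->
    `|x_ m - x_ n| ^+ 2 + t * `|T (x_ m) - T (x_ n)| ^+ 2 <= 4 * m.+1%:R^-1.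
  move=> mn; have [Tm qm] := xP m; have [Tn qn] := xP n.
  apply: mini => //; first exact: ltW.
  by rewrite (le_trans (ltW qn))// lerD2l lef_pV2 ?posrE// ler_nat.
have [x xx] : exists x, forall e : C, 0 < e -> exists N, forall n, (N <= n)%N -> `|x - x_ n| < e.
  apply: cauchy_limit => e e0.
  have [N Nn] := archC _ (divr_gt0 (exprn_gt0 2 e0) (ltr0n C 4)).
  exists N => n Nle; rewrite -(@ltr_pXn2r _ 2)// ?nnegrE ?(ltW e0)//.
  have := Nn _ (leqnn N); rewrite ltr_pdivlMr// mulrC; apply: le_lt_trans.
  apply: le_trans (xd _ _ Nle); rewrite lerDl mulr_ge0 ?exprn_ge0// ltW//.
have [y yy] : exists y, forall e : C, 0 < e -> exists N, forall n, (N <= n)%N -> `|y - T (x_ n)| < e.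
  apply: (@cauchy_limit (fun n => T (x_ n))) => e e0.
  have [N Nn] := archC _ (divr_gt0 (mulr_gt0 t0 (exprn_gt0 2 e0)) (ltr0n C 4)).
  exists N => n Nle; rewrite -(@ltr_pXn2r _ 2)// ?nnegrE ?(ltW e0)//.
  have := Nn _ (leqnn N); rewrite ltr_pdivlMr// mulrC.
  move=> /(le_lt_trans (xd _ _ Nle)) h'; rewrite -(ltr_pM2l t0).
  by apply: le_lt_trans h'; rewrite lerDr exprn_ge0.
have [Tx yE] : opdom T x /\ y = T x.
  apply: cT => e e0; have [N Nn] := xx _ e0; have [N' Nn'] := yy _ e0.
  exists (x_ (maxn N N')); split; first by case: (xP (maxn N N')).
    by apply: Nn; rewrite leq_maxl.
  by apply: Nn'; rewrite leq_maxr.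
(* Orthogonality passes to the limit: [var] bounds the pairing at [x_ n], and Cauchy-Schwarz bounds
   the two errors from replacing [x] by [x_ n]. *)
exists x => // u Tu; apply: small_eq0 => e e0.
pose e3 := e / 3; have e30 : 0 < e3 by rewrite divr_gt0.
pose Q := `|u| ^+ 2 + t * `|T u| ^+ 2 + 1.
have Q0 : 0 < Q by rewrite ltr_wpDl// addr_ge0 ?exprn_ge0 ?mulr_ge0 ?exprn_ge0// ltW.
have [N1 h1] := archC _ (divr_gt0 (exprn_gt0 2 e30) Q0).
have u1 : 0 < `|u| + 1 by rewrite ltr_wpDl.
have u2 : 0 < t * (`|T u| + 1) by rewrite mulr_gt0// ltr_wpDl.
have [N2 h2] := xx _ (divr_gt0 e30 u1).
have [N3 h3] := yy _ (divr_gt0 e30 u2).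
pose n := maxn N1 (maxn N2 N3); have [Tn qn] := xP n.
have {}h2 : `|x - x_ n| * (`|u| + 1) <= e3.
  by rewrite -ler_pdivlMr// ltW// h2// !leq_max leqnn orbT.
have {}h3 : t * (`|T x - T (x_ n)| * (`|T u| + 1)) <= e3.
  by rewrite mulrCA -ler_pdivlMr// ltW// -yE h3// !leq_max leqnn !orbT.
have {}h1 : `|inner (h - x_ n) u + t * inner (k - T (x_ n)) (T u)| <= e3.
  rewrite -(@ler_pXn2r _ 2)// ?nnegrE ?(ltW e30)//.
  rewrite (le_trans (var _ _ _ Tn Tu (ltW qn)))//.
  by rewrite -ler_pdivlMr// ltW// h1// leq_max leqnn.
have -> : inner (h - x) u + t * inner (k - T x) (T u) =
  inner (h - x_ n) u + t * inner (k - T (x_ n)) (T u)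
  - inner (x - x_ n) u - t * inner (T x - T (x_ n)) (T u).
  by rewrite !innerBl; ring.
have -> : e = e3 + e3 + e3 by rewrite /e3; field.
rewrite (le_trans (ler_normB _ _))// lerD//.
  rewrite (le_trans (ler_normB _ _))// lerD//.
  apply: le_trans h2; rewrite (le_trans (inner_leM _ _))//.
  by rewrite ler_wpM2l// lerDl.
apply: le_trans h3; rewrite normrM (gtr0_norm t0) ler_wpM2l ?(ltW t0)//.
by rewrite (le_trans (inner_leM _ _))// ler_wpM2l// lerDl.
Qed.

End Closed.

(** * Vector-valued polynomials *)

Section VectorPolynomials.
Context (C : numClosedFieldType) (H : hilbertType C).
Implicit Types (f : C -> H) (c : nat -> H) (mu nu r M : C).

(** Quantifying over all large [n] avoids exact degrees; the coefficients from [d] on vanish. *)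
Definition vpoly f c := exists d, forall n, (d <= n)%N ->
  forall mu, f mu = \sum_(j < n) mu ^+ j *: c j.

Lemma vpoly_const (v : H) : vpoly (fun=> v) (fun j => if j is 0 then v else 0).
Proof.
exists 1%N => -[//|n] _ mu.
by rewrite big_ord_recl expr0 scale1r big1 ?addr0// => i _; rewrite scaler0.
Qed.

Lemma vpoly_comp (L : {linear H -> H}) f c : vpoly f c -> vpoly (L \o f) (L \o c).
Proof.
move=> [d fd]; exists d => n dn mu /=; rewrite (fd _ dn) linear_sum.
by apply: eq_bigr => i _; rewrite linearZ.
Qed.

Lemma vpoly_step (L L' : {linear H -> H}) f c : vpoly f c ->
  vpoly (fun mu => L (f mu) + mu *: L' (f mu))
        (fun j => L (c j) + if j is j'.+1 then L' (c j') else 0).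
Proof.
move=> [d fd]; exists d.+1 => -[//|n] dn mu.
under eq_bigr do rewrite scalerDr.
rewrite big_split; congr (_ + _).
  rewrite (fd _ (ltnW dn)).
  rewrite (linear_sum L).
  by apply: eq_bigr => i _; rewrite linearZ.
rewrite (fd n dn) (linear_sum L') scaler_sumr [RHS]big_ord_recl /= scaler0 add0r.
by apply: eq_bigr => i _; rewrite linearZ/= scalerA -exprS.
Qed.

(** Only the first two terms of the binomial expansion matter later. The truncated [n.-1] is
    harmless at 0, where the factor [n%:R] vanishes. *)
Lemma vpoly_iter (L L' : {linear H -> H}) n f c :
  (forall v, L (L' v) = L' (L v)) -> vpoly f c ->
  exists c', [/\ vpoly (fun mu => iter n (fun v => L v + mu *: L' v) (f mu)) c',
    c' 0%N = iter n L (c 0%N) &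
    c' 1%N = iter n L (c 1%N) + n%:R *: iter n.-1 L (L' (c 0%N))].
Proof.
move=> LL' fc; elim: n => [|n [c' [fc' c0 c1]]].
  by exists c; rewrite scale0r addr0.
exists (fun j => L (c' j) + if j is j'.+1 then L' (c' j') else 0).
split; [exact: vpoly_step|by rewrite c0 addr0|].
have com m v : L' (iter m L v) = iter m L (L' v).
  by elim: m => //= m IH; rewrite -LL' IH.
rewrite c1 c0 linearD linearZ/= com -addrA; congr (_ + _).
case: n {fc' c0 c1} => [|n] /=; first by rewrite scale0r add0r scale1r.
by rewrite -[n.+2]addn1 natrD scalerDl scale1r.
Qed.

Lemma sum_even_odd (F : nat -> H) m :
  \sum_(j < m.*2) F j = \sum_(j < m) (F j.*2 + F j.*2.+1).
Proof.
elim: m => [|m IH]; first by rewrite !big_ord0.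
by rewrite doubleS !big_ord_recr /= IH addrA.
Qed.

(* Averaging over [mu] and [-mu] halves the degree in [mu ^+ 2]. *)
Lemma coef0_bound k c r M : 0 <= r ->
  (forall mu, `|mu| = r -> `|\sum_(j < 2 ^ k) mu ^+ j *: c j| <= M) -> `|c 0%N| <= M.
Proof.
elim: k c r => [|k IH] c r r0 cM.
  by have := cM _ (ger0_norm r0); rewrite big_ord_recl big_ord0 expr0 scale1r addr0.
apply: (IH (fun j => c j.*2) (r ^+ 2)); first exact: exprn_ge0.
move=> nu nur; pose mu := sqrtC nu.
have mur : `|mu| = r.
  apply/eqP; rewrite -(@eqrXn2 _ 2)// -normrX sqrtCK nur//.
have -> : \sum_(j < 2 ^ k) nu ^+ j *: c j.*2 =
    2^-1 *: (\sum_(j < 2 ^ k.+1) mu ^+ j *: c j + \sum_(j < 2 ^ k.+1) (- mu) ^+ j *: c j).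
  rewrite expnS mul2n -big_split/= (sum_even_odd (fun j => mu ^+ j *: c j + (- mu) ^+ j *: c j)).
  rewrite scaler_sumr; apply: eq_bigr => i _ /=.
  rewrite !exprS -mul2n !exprM sqrrN sqrtCK mulNr scaleNr subrr addr0.
  by rewrite -mulr2n -(scaler_nat 2 (_ *: _)) !scalerA mulKf// pnatr_eq0.
rewrite normrZ normfV normr_nat ler_pdivrMl// mulr_natl mulr2n.
by rewrite (le_trans (ler_normD _ _))// lerD// cM// normrN.
Qed.

(** Cauchy estimate without integrals: [(f mu - f (- mu)) / (2 mu)] is a polynomial in [mu ^+ 2]
    with constant term [c 1], so [coef0_bound] applies. *)
Lemma vpoly_coef1_bound f c r M : 0 < r -> vpoly f c ->
  (forall mu, `|mu| = r -> `|f mu| <= M) -> r * `|c 1%N| <= M.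
Proof.
move=> r0 [d fd] fM; rewrite mulrC -ler_pdivlMr//.
(* Rounding the length up to a power of two leaves [2 ^ d] odd terms, the shape needed for
   [coef0_bound]. *)
have dn : (d <= 2 ^ d.+1)%N.
  by apply: leq_trans (leq_pexp2l (ltn0Sn 1) (leqnSn d)); rewrite ltnW// ltn_expl.
apply: (@coef0_bound d (fun j => c j.*2.+1) (r ^+ 2)); first by rewrite exprn_ge0// ltW.
move=> nu nur; pose mu := sqrtC nu.
have mur : `|mu| = r.
  by apply/eqP; rewrite -(@eqrXn2 _ 2)// ?ltW// -normrX sqrtCK nur.
have mu0 : mu != 0 by rewrite -normr_gt0 mur.
have -> : \sum_(j < 2 ^ d) nu ^+ j *: c j.*2.+1 = (2 * mu)^-1 *: (f mu - f (- mu)).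
  rewrite !(fd _ dn) -sumrB expnS mul2n.
  rewrite (sum_even_odd (fun j => mu ^+ j *: c j - (- mu) ^+ j *: c j)).
  rewrite scaler_sumr; apply: eq_bigr => i _ /=.
  rewrite !exprS -mul2n !exprM sqrrN sqrtCK subrr add0r mulNr scaleNr opprK.
  rewrite -mulr2n -(scaler_nat 2 (_ *: _)) !scalerA; congr (_ *: _); field.
  by rewrite mu0.
rewrite normrZ normfV normrM normr_nat mur ler_pdivrMl ?mulr_gt0//.
have -> : 2 * r * (M / r) = M + M by field; rewrite gt_eqF.
by rewrite (le_trans (ler_normB _ _))// lerD// fM// normrN.
Qed.

End VectorPolynomials.

(** * The Fuglede-Putnam estimate for bounded operators *)

Section BoundedEstimate.
Context (C : numClosedFieldType) (H : hilbertType C).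
Implicit Types (x y z v : H).

Lemma linearDZ (L : {linear H -> H}) (a : C) x y : L (x + a *: y) = L x + a *: L y.
Proof. by rewrite linearD linearZ. Qed.

Lemma iter_linearZ (L : {linear H -> H}) n (a : C) v :
  iter n L (a *: v) = a *: iter n L v.
Proof. by elim: n => //= n ->; rewrite linearZ. Qed.

Lemma iter_linear0 (L : {linear H -> H}) n : iter n L 0 = 0.
Proof. by rewrite -[X in iter n L X](scale0r 0) iter_linearZ scale0r. Qed.

Lemma iter_linearD (L : {linear H -> H}) n x y :
  iter n L (x + y) = iter n L x + iter n L y.
Proof. by elim: n => //= n ->; rewrite linearD. Qed.

Lemma iter_comm (f g : H -> H) n v : (forall v, f (g v) = g (f v)) ->
  iter n f (g v) = g (iter n f v).
Proof. by move=> fg; elim: n => //= n ->. Qed.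

Lemma iter2_comm (f g : H -> H) m n v : (forall v, f (g v) = g (f v)) ->
  iter m f (iter n g v) = iter n g (iter m f v).
Proof. by move=> fg; elim: n => //= n <-; rewrite iter_comm. Qed.

(** Each factor [N'] is commuted to the outside of the powers of [N] and replaced there by [N],
    using [|N' x| = |N x|]. *)
Lemma normal_iter_norm (N N' : H -> H) n z :
  (forall x y, inner (N x) y = inner x (N' y)) ->
  (forall x, N (N' x) = N' (N x)) ->
  `|iter n N' z| = `|iter n N z|.
Proof.
move=> adj com.
have norm x : `|N' x| = `|N x|.
  apply/eqP; rewrite -(@eqrXn2 _ 2)// !normr_inner adj -com.
  by rewrite innerC -adj -innerC.
elim: n z => // n IH z.
by rewrite iterSr IH iter_comm// norm.
Qed.

(* Models [E = (1 + t T^*T)^-1], [K = TE], [K' = T^*E] for a normal [T]. *)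
Definition resolvent_triple (t : C) (E K K' : H -> H) :=
  [/\ forall x y, inner (E x) y = inner x (E y),
      forall x y, inner (K x) y = inner x (K' y),
      forall x, E (K x) = K (E x),
      forall x, K (K' x) = K' (K x) &
      forall x, E x = E (E x) + t *: K' (K x)].

Context (t : C) (t0 : 0 <= t).

Lemma resolvent_triple_comm E K K' : resolvent_triple t E K K' ->
  forall x, E (K' x) = K' (E x).
Proof.
move=> [sE aK EK _ _] x; apply: inner_inj => z.
have aK' u v : inner (K' u) v = inner u (K v) by rewrite innerC -aK -innerC.
by rewrite sE aK' -EK -sE aK'.
Qed.

(** Pairing [E x] with [x] gives [|E x|^2 + t |K x|^2], which is at most [|E x| |x|]. *)
Lemma resolvent_triple_contract E K K' : resolvent_triple t E K K' ->
  forall x, `|E x| <= `|x|.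
Proof.
move=> [sE aK _ _ EE] x.
have aK' u v : inner (K' u) v = inner u (K v) by rewrite innerC -aK -innerC.
have [->//|Ex0] := eqVneq (E x) 0; first by rewrite normr0.
rewrite -(ler_pM2l (_ : 0 < `|E x|)) ?normr_gt0// -expr2.
apply: le_trans (inner_leM _ _).
have -> : inner (E x) x = `|E x| ^+ 2 + t * `|K x| ^+ 2.
  by rewrite {1}EE innerDl innerZl aK' sE -!normr_inner.
rewrite ger0_norm ?addr_ge0 ?mulr_ge0 ?exprn_ge0//.
by rewrite lerDl mulr_ge0 ?exprn_ge0.
Qed.

(* For a complex number [w], [|1 - w ^+ 2| <= 1 + |w| ^+ 2]. *)
Lemma resolvent_triple_bound (E K K' : {linear H -> H}) (a : C) :
  resolvent_triple t E K K' -> `|a| ^+ 2 = t ->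
  forall x, `|E (E x) - a ^+ 2 *: K (K x)| <= `|x|.
Proof.
move=> tr at2 x; have EK' := resolvent_triple_comm tr.
apply: le_trans (resolvent_triple_contract tr x).
have [sE aK EK KK' EE] := tr.
rewrite -(@ler_pXn2r _ 2)// ?nnegrE//.
have aK' u v : inner (K' u) v = inner u (K v) by rewrite innerC -aK -innerC.
have nK u : `|K' u| = `|K u| by exact: (@normal_iter_norm K K' 1).
(* Both sides become [|E E x|^2 + t^2 |K K x|^2] plus a cross term; on the right it is
   [2 t |K E x|^2], which also bounds the one on the left. *)
rewrite [in leRHS]EE normrB2 normrD2 !innerZr.
rewrite (normrZ _ (K (K x))) (normrZ _ (K' (K x))) normrX at2 (ger0_norm t0).
have -> : `|K' (K x)| = `|K (K x)| by exact: nK.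
have tr' : t^* = t by apply/CrealP/ger0_real.
have -> : inner (E (E x)) (K' (K x)) = `|K (E x)| ^+ 2.
  by rewrite -aK -EK sE EK normr_inner.
set i := inner _ (K (K x)); set b := (a ^+ 2)^* * i.
have bZ : `|b| <= t * `|K (E x)| ^+ 2.
  rewrite normrM norm_conjC normrX at2 ler_wpM2l// /i -aK' -EK' sE EK.
  by rewrite (le_trans (inner_leM _ _))// nK expr2.
have bb : - (b + b^*) <= `|b| *+ 2.
  rewrite (le_trans (real_ler_norm _))//.
    by rewrite rpredN; apply/CrealP; rewrite rmorphD/= conjCK addrC.
  by rewrite normrN (le_trans (ler_normD _ _))// norm_conjC mulr2n.
clearbody b; rewrite tr' (_ : (t * `|K (E x)| ^+ 2)^* = t * `|K (E x)| ^+ 2); last first.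
  by apply/CrealP/ger0_real; rewrite mulr_ge0 ?exprn_ge0.
by rewrite -mulr2n lerD2l (le_trans bb)// lerMn2r bZ orbT.
Qed.

(** The inner factor is the adjoint of the normal [N = E - a K], so under the norm [N] may replace
    it. With [M = E + a K], the product [N M = E^2 - a^2 K^2] is a contraction. *)
Lemma resolvent_triple_iter_bound (E K K' : {linear H -> H}) (a : C) n :
  resolvent_triple t E K K' -> `|a| ^+ 2 = t -> forall v,
  `|iter n (fun v => E v + a *: K v) (iter n (fun v => E v + a^* *: (- K' v)) v)| <= `|v|.
Proof.
move=> tr at2 v; have EK' := resolvent_triple_comm tr.
have [sE aK EK KK' EE] := tr.
have aK' u w : inner (K' u) w = inner u (K w) by rewrite innerC -aK -innerC.
pose linE := (linearDZ E, linearDZ K, linearDZ K', linearN E, linearN K, linearN K').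
rewrite iter2_comm; last first.
  move=> w; rewrite !linE !EK !EK' !KK' !opprD !scalerDr !scalerN !scalerA.
  by rewrite addrACA [a * _]mulrC.
pose M v := E v + a *: K v; pose N v := E v + a *: (- K v).
have adjN x y : inner (N x) y = inner x (E y + a^* *: - K' y).
  by rewrite innerDl innerDr innerZl innerZr conjCK innerNl innerNr sE aK.
have comN x : N (E x + a^* *: - K' x) = E (N x) + a^* *: - K' (N x).
  rewrite /N !linE !EK !EK' !KK' !opprD !scalerDr !scalerN !scalerA.
  by rewrite addrACA [a * _]mulrC.
rewrite (normal_iter_norm _ _ adjN comN).
have MN x : M (N x) = N (M x).
  rewrite /M /N !linE !EK !opprD !scalerDr !scalerN.
  by rewrite addrACA.
elim: n v => // n IH v; rewrite iterSr [iter n.+1 _ v]iterSr -(iter_comm _ _ MN).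
apply: le_trans (IH _) _; rewrite {IH}.
suff -> : N (M v) = E (E v) - a ^+ 2 *: K (K v) by exact: (resolvent_triple_bound tr at2).
rewrite /M /N !linE !EK !opprD !scalerDr !scalerN !scalerA -expr2.
by rewrite addrA addrK.
Qed.

Lemma iter_bound (f : H -> H) n v : (forall v, `|f v| <= `|v|) -> `|iter n f v| <= `|v|.
Proof. by move=> fb; elim: n => //= n; apply: le_trans. Qed.

(* Since [t = |mu| ^+ 2], replacing [F + mu *: G'] by its adjoint and moving
   it to the right of [A] turns the product into a contraction. *)
Lemma intertwined_bound (E K K' F G G' A : {linear H -> H}) (mu c : C) n :
  resolvent_triple t E K K' -> resolvent_triple t F G G' ->
  (forall v, G (A (E v)) = F (A (K v))) ->
  0 <= c -> (forall v, `|A v| <= c * `|v|) ->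
  `|mu| ^+ 2 = t -> forall v,
  `|iter n (fun v => F v + mu *: G' v)
     (A (iter n (fun v => E v + mu *: (\- K') v) (iter n E v)))| <= c * `|v|.
Proof.
move=> trE trF GAE c0 Ac mut v.
have EK' := resolvent_triple_comm trE; have FG' := resolvent_triple_comm trF.
have [_ _ EK _ _] := trE; have [sF aG FG GG' _] := trF.
pose linE := (linearDZ E, linearDZ K, linearDZ K', linearN E, linearN K, linearN K',
  linearDZ F, linearDZ G, linearDZ G').
pose a := mu^*; have amu : a^* = mu by rewrite /a conjCK.
have at2 : `|a| ^+ 2 = t by rewrite norm_conjC.
rewrite -amu.
pose M v := E v + a *: K v; pose N v := F v + a *: G v.
(* [F + mu G'] is the adjoint of the normal [N], hence gives the same norms. *)
rewrite (@normal_iter_norm N); last 2 first.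
- by move=> x y; rewrite innerDl innerDr innerZl innerZr conjCK sF aG.
- move=> x; rewrite /N !linE !FG !FG' !GG' !scalerDr !scalerA.
  by rewrite addrACA [a * _]mulrC.
(* The intertwining relation reads [N A E = F A M]: each factor [E] pays for moving one factor [N]
   through [A]. *)
have NAE w : iter n N (A (iter n E w)) = iter n F (A (iter n M w)).
  have EM x : E (M x) = M (E x) by rewrite /M !linE EK.
  have NF x : N (F x) = F (N x) by rewrite /N !linE FG.
  elim: n w => // m IH w; rewrite iterSr [iter m.+1 E w]iterS.
  have -> : N (A (E (iter m E w))) = F (A (M (iter m E w))).
    by rewrite /N GAE /M linearDZ linearDZ.
  by rewrite -(iter_comm _ _ EM) (iter_comm _ _ NF) IH [iter m.+1 M w]iterSr.
have EN' x : E (E x + a^* *: - K' x) = E (E x) + a^* *: - K' (E x).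
  by rewrite !linE EK'.
rewrite -(iter2_comm n n v EN') NAE.
apply: le_trans (iter_bound _ _ (resolvent_triple_contract trF)) _.
apply: le_trans (Ac _) _; rewrite ler_wpM2l//.
exact: resolvent_triple_iter_bound.
Qed.

(** Cauchy estimate for the polynomial in [mu] bounded by [intertwined_bound]; both powers
    contribute the factor [n.+1] to its linear coefficient. *)
Lemma intertwined_coef1_bound (E K K' F G G' A : {linear H -> H}) (r c : C) n :
  resolvent_triple t E K K' -> resolvent_triple t F G G' ->
  (forall v, G (A (E v)) = F (A (K v))) ->
  0 <= c -> (forall v, `|A v| <= c * `|v|) -> 0 < r -> r ^+ 2 = t ->
  forall v, r * n.+1%:R *
    `|iter n F (G' (A (iter n.+1 E (iter n.+1 E v)))) -
      iter n.+1 F (A (iter n E (K' (iter n.+1 E v))))| <= c * `|v|.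
Proof.
move=> trE trF GAE c0 Ac r0 rt v.
have EK' := resolvent_triple_comm trE; have FG' := resolvent_triple_comm trF.
have EK'N x : E ((\- K') x) = (\- K') (E x) by rewrite /= linearN EK'.
have [p1 [P1 p10 p11]] := vpoly_iter n.+1 EK'N (vpoly_const (iter n.+1 E v)).
have [p [P p0 p1']] := vpoly_iter n.+1 FG' (vpoly_comp A P1).
have := vpoly_coef1_bound r0 P.
move=> /(_ (c * `|v|)); rewrite p1' [(A \o p1) _]/= [(A \o p1) _]/= p10 p11.
rewrite iter_linear0 add0r linearZZ iter_linearZ -scalerDr normrZ normr_nat.
rewrite -[_ (iter n.+1 E v)]scaleN1r.
rewrite iter_linearZ linearZZ iter_linearZ scaleN1r addrC mulrA; apply.
move=> mu mur; have mut : `|mu| ^+ 2 = t by rewrite mur.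
exact: (intertwined_bound n.+1 trE trF GAE c0 Ac mut v).
Qed.

End BoundedEstimate.

(** * Adjoints and resolvents *)

Section Adjoint.
Context (C : numClosedFieldType) (infC : has_infima C)
  (archC : archimedean_closed C) (H : hilbertType C).
Implicit Types (T M : operator H) (x y z u v w h k : H).

Lemma adjointP T (dT : densely_defined T) x y : opdom T x ->
  opdom (adjoint dT) y -> inner (T x) y = inner x (adjoint dT y).
Proof. by move=> Tx Ty; exact: (adjoint_funP Ty). Qed.

Lemma adjointPl T (dT : densely_defined T) x y : opdom T x ->
  opdom (adjoint dT) y -> inner (adjoint dT y) x = inner y (T x).
Proof. by move=> Tx Ty; rewrite innerC -adjointP// -innerC. Qed.

Lemma adjoint_intro T (dT : densely_defined T) y z :
  (forall x, opdom T x -> inner (T x) y = inner x z) ->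
  opdom (adjoint dT) y /\ adjoint dT y = z.
Proof.
move=> yz; have Ty : adjoint_dom T y by exists z.
split=> //; exact: (adjoint_rel_uniq dT (adjoint_funP Ty)).
Qed.

(** The residual of projecting [(y, z)] onto the graph is orthogonal to it, hence of the form
    [(- T^* w, w)]; the hypothesis then makes it zero. *)
Lemma biadjoint T (dT : densely_defined T) y z : closed_op T ->
  (forall w, opdom (adjoint dT) w -> inner (adjoint dT w) y = inner w z) ->
  opdom T y /\ T y = z.
Proof.
move=> cT yz; have [x Tx xP] := graph_projection y z infC archC cT ltr01.
have [Tw Twx] : opdom (adjoint dT) (z - T x) /\ adjoint dT (z - T x) = x - y.
  apply: adjoint_intro => u Tu; apply/eqP; rewrite -subr_eq0.
  have := xP _ Tu; rewrite mul1r => /(congr1 Num.conj).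
  by rewrite rmorphD/= -!innerC rmorph0 -[y - x]opprB innerNr addrC => ->.
have : `|y - x| ^+ 2 + `|z - T x| ^+ 2 = 0.
  rewrite !normr_inner [inner (z - _) _]innerBr -(yz _ Tw) -(adjointPl Tx Tw) Twx.
  by rewrite -innerBr -[x - y]opprB innerNl subrr.
move=> /eqP; rewrite paddr_eq0 ?exprn_ge0// => /andP[].
rewrite !sqrf_eq0 !normr_eq0 !subr_eq0 => /eqP -> /eqP -> //.
Qed.

(** When [(0, k)] is projected onto the graph, the second component of the residual is the
    solution. *)
Lemma coresolvent_ex T (dT : densely_defined T) k : closed_op T ->
  exists w, [/\ opdom (adjoint dT) w, opdom T (adjoint dT w) &
    w + T (adjoint dT w) = k].
Proof.
move=> cT; have [x Tx xP] := graph_projection 0 k infC archC cT ltr01.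
have [Tw Twx] : opdom (adjoint dT) (k - T x) /\ adjoint dT (k - T x) = x.
  apply: adjoint_intro => u Tu; apply/eqP; rewrite -subr_eq0.
  have := xP _ Tu; rewrite mul1r sub0r => /(congr1 Num.conj).
  by rewrite rmorphD/= -!innerC rmorph0 innerNr addrC => ->.
by exists (k - T x); rewrite Twx subrK.
Qed.

(** The relation [u = (1 + t T^*T)^-1 h]; existence and uniqueness are separate lemmas. *)
Definition resolvent_at T (dT : densely_defined T) (t : C) h u :=
  [/\ opdom T u, opdom (adjoint dT) (T u) & u + t *: adjoint dT (T u) = h].

(** Here [(h, 0)] is projected: orthogonality to the graph says [T^*T x = (h - x) / t]. *)
Lemma resolvent_ex T (dT : densely_defined T) (t : C) h : 0 < t -> closed_op T ->
  exists u, resolvent_at dT t h u.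
Proof.
move=> t0 cT; have [x Tx xP] := graph_projection h 0 infC archC cT t0.
have tn0 : t != 0 by rewrite gt_eqF.
have [Tw Twx] : opdom (adjoint dT) (T x) /\ adjoint dT (T x) = t^-1 *: (h - x).
  apply: adjoint_intro => u Tu.
  have := xP _ Tu; rewrite sub0r innerNl mulrN => /eqP; rewrite subr_eq0 => /eqP xu.
  have tr : (t^-1)^* = t^-1 by apply/CrealP/gtr0_real; rewrite invr_gt0.
  by rewrite innerZr tr [inner u _]innerC xu rmorphM/= -innerC (CrealP (gtr0_real t0)) mulKf.
by exists x; split=> //; rewrite Twx scalerA mulfV// scale1r subrKC.
Qed.

Lemma resolvent_uniq T (dT : densely_defined T) (t : C) h u v : 0 < t ->
  resolvent_at dT t h u -> resolvent_at dT t h v -> u = v.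
Proof.
move=> t0 [Tu Tu' uh] [Tv Tv' vh]; apply/eqP; rewrite -subr_eq0.
have Td := opdomB Tu Tv; have Td' := opdomB Tu' Tv'.
have d0 : (u - v) + t *: adjoint dT (T (u - v)) = 0.
  by rewrite opB// opB// scalerBr addrACA -opprD uh vh subrr.
have : inner ((u - v) + t *: adjoint dT (T (u - v))) (u - v) = 0.
  by rewrite d0 inner0l.
rewrite innerDl innerZl adjointPl//; last by rewrite opB.
rewrite -!normr_inner => /eqP; rewrite paddr_eq0 ?exprn_ge0//; last by rewrite mulr_ge0 ?exprn_ge0 ?(ltW t0).
by rewrite sqrf_eq0 normr_eq0 => /andP[].
Qed.

Lemma resolvent_linear T (dT : densely_defined T) (t : C) (a : C) h k u v :
  resolvent_at dT t h u -> resolvent_at dT t k v ->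
  resolvent_at dT t (a *: h + k) (a *: u + v).
Proof.
move=> [Tu Tu' <-] [Tv Tv' <-]; split; rewrite ?op_linear//; try exact: opdomP.
by rewrite scalerDr addrACA scalerDr !scalerA [t * a]mulrC.
Qed.

(** Obtained by pairing [h - u = t T^*T u] with [h - u]; used to approximate vectors of the domain
    of [T] by vectors of the domain of [T^*T]. *)
Lemma resolvent_norm T (dT : densely_defined T) (t : C) h u : 0 < t ->
  opdom T h -> resolvent_at dT t h u -> `|h - u| ^+ 2 <= t * `|T h| ^+ 2.
Proof.
move=> t0 Th [Tu Tu' uh]; have Td := opdomB Th Tu.
have hu : h - u = t *: adjoint dT (T u) by rewrite -{1}uh addrC addrA addNr add0r.
have id : `|h - u| ^+ 2 + t * `|T h - T u| ^+ 2 = t * inner (T h) (T h - T u).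
  rewrite !normr_inner {1}hu innerZl adjointPl// opB// -mulrDr.
  by rewrite -innerDl subrKC.
have {id} le1 : `|h - u| ^+ 2 + t * `|T h - T u| ^+ 2 <= t * (`|T h| * `|T h - T u|).
  have := inner_leM (T h) (T h - T u); rewrite -(ler_pM2l t0); apply: le_trans.
  rewrite -[t in t * `|inner _ _|](gtr0_norm t0) -normrM -id.
  by rewrite ger0_norm// addr_ge0 ?exprn_ge0// mulr_ge0 ?exprn_ge0// ltW.
set a := `|T h - T u| in le1; set b := `|T h| in le1 *.
rewrite -lerBrDr -mulrBr in le1; apply: (le_trans le1).
rewrite ler_pM2l// -subr_ge0.
have -> : b ^+ 2 - (b * a - a ^+ 2) = (b - a) ^+ 2 + b * a by ring.
by apply: addr_ge0; [rewrite -realEsqr; apply: rpredB; exact: normr_real|apply: mulr_ge0; exact: normr_ge0].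
Qed.

End Adjoint.

(** * The Fuglede-Putnam theorem *)

Section FugledePutnam.
Context (C : numClosedFieldType) (infC : has_infima C)
  (archC : archimedean_closed C) (H : hilbertType C).
Implicit Types (T M : operator H) (x y z u v w h k : H).

Definition normal_resolvent T (dT : densely_defined T) (t : C) (E K K' : {linear H -> H}) :=
  [/\ resolvent_triple t E K K',
      forall h, resolvent_at dT t h (E h),
      forall h, [/\ opdom (adjoint dT) (E h), K h = T (E h) & K' h = adjoint dT (E h)],
      forall x, opdom T x -> E (T x) = K x &
      forall x, opdom (adjoint dT) x -> E (adjoint dT x) = K' x].

(** Uniqueness of resolvents yields both the linearity of [E] and its commutation with [T] and
    [T^*]. *)
Lemma normal_resolvent_ex T (dT : densely_defined T) (t : C) : 0 < t ->
  closed_op T -> op_eq (opcomp T (adjoint dT)) (opcomp (adjoint dT) T) ->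
  exists E K K', normal_resolvent dT t E K K'.
Proof.
move=> t0 cT [nT nT'].
have {nT} nT x : opdom (adjoint dT) x -> opdom T (adjoint dT x) ->
    [/\ opdom T x, opdom (adjoint dT) (T x) & T (adjoint dT x) = adjoint dT (T x)].
  by move=> h1 h2; have [/(_ x (conj h1 h2)) [? ?]] := nT; move/(_ x (conj h1 h2)).
have {nT'} nT' x : opdom T x -> opdom (adjoint dT) (T x) ->
    [/\ opdom (adjoint dT) x, opdom T (adjoint dT x) & adjoint dT (T x) = T (adjoint dT x)].
  by move=> h1 h2; have [/(_ x (conj h1 h2)) [? ?]] := nT'; move/(_ x (conj h1 h2)).
have /choice[E0 E0P] h := resolvent_ex infC archC dT h t0 cT.
have E0lin : linear E0.
  move=> a x y; apply: (resolvent_uniq t0 (E0P _)).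
  exact: resolvent_linear.
pose E : {linear H -> H} := HB.pack E0 (GRing.isLinear.Build C H H *:%R E0 E0lin).
have EP h : resolvent_at dT t h (E h) by exact: E0P.
have ET h : opdom T (E h) by case: (EP h).
have ET' h : opdom (adjoint dT) (E h).
  by have [h1 h2 _] := EP h; case: (nT' _ h1 h2).
have TElin : linear (T \o E).
  by move=> a x y; rewrite /comp (linearP E) op_linear.
have T'Elin : linear (adjoint dT \o E).
  by move=> a x y; rewrite /comp (linearP E) op_linear.
pose K : {linear H -> H} := HB.pack (T \o E) (GRing.isLinear.Build C H H *:%R (T \o E) TElin).
pose K' : {linear H -> H} := HB.pack (adjoint dT \o E) (GRing.isLinear.Build C H H *:%R _ T'Elin).
have tn0 : t != 0 by rewrite gt_eqF.
have tE h : t *: adjoint dT (T (E h)) = h - E h.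
  by have [_ _ e] := EP h; rewrite -[X in X - _]e addrC addKr.
have tE' h : adjoint dT (T (E h)) = t^-1 *: (h - E h).
  by rewrite -tE scalerA mulVf// scale1r.
have EK x : opdom T x -> E (T x) = K x.
  move=> Tx; apply: (resolvent_uniq t0 (EP _)); have [h1 h2 h3] := EP x.
  (* [T^*T E x] is a multiple of [x - E x], so it lies in the domain of [T]; normality then
     exchanges [T] and [T^*] on [T E x]. *)
  have h4 : opdom T (adjoint dT (T (E x))) by rewrite tE'; exact/opdomZ/opdomB.
  have [h5 h6 h7] := nT _ h2 h4; split=> //.
  by rewrite -[K x]/(T (E x)) -h7 -opZ// -opD ?h3//; exact: opdomZ.
have EK' x : opdom (adjoint dT) x -> E (adjoint dT x) = K' x.
  move=> Tx; apply: (resolvent_uniq t0 (EP _)); have [h1 h2 h3] := EP x.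
  have [h4 h5 h6] := nT' _ h1 h2.
  have h7 : opdom (adjoint dT) (adjoint dT (T (E x))).
    by rewrite tE'; exact/opdomZ/opdomB.
  split=> //; rewrite -[K' x]/(adjoint dT (E x)) -h6//.
  by rewrite -opZ// -opD ?h3//; exact: opdomZ.
exists E, K, K'; split=> //; split.
- move=> x y; have [h1 h2 h3] := EP x; have [h1' h2' h3'] := EP y.
  rewrite -[X in _ = inner X _]h3 -[X in inner _ X = _]h3' innerDl innerDr innerZl innerZr (CrealP (gtr0_real t0)).
  by rewrite adjointPl// adjointP.
- move=> x y /=; have [h1 h2 h3] := EP x; have [h1' h2' h3'] := EP y.
  have [h4 h5 h6] := nT' _ h1' h2'.
  rewrite -[X in _ = inner X _]h3 -[X in inner _ X = _]h3' innerDl innerDr innerZl innerZr (CrealP (gtr0_real t0)).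
  by rewrite adjointPl// h6 adjointP// innerC -adjointPl// -innerC.
- by move=> x; rewrite -(EK (E x)).
- move=> x; change (T (E (adjoint dT (E x))) = adjoint dT (E (T (E x)))).
  rewrite EK'// EK//; have [h1 h2 _] := EP (E x).
  by have [_ _ e] := nT' _ h1 h2; symmetry.
- move=> x; have [_ _ e] := EP (E x); rewrite -[LHS]e; congr (_ + _ *: _).
  by change (adjoint dT (T (E (E x))) = adjoint dT (E (T (E x)))); rewrite EK.
Qed.

(** On the domain of [T^*T] one has [y - E y = t E T^*T y], so [k] applications of [E] move [y] by
    at most [k t |T^*T y|]. Density and contractivity give the rest, with [d] independent of [t] and
    [k]. *)
Lemma resolvent_iter_cvg T (dT : densely_defined T) : closed_op T ->
  op_eq (opcomp T (adjoint dT)) (opcomp (adjoint dT) T) ->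
  forall y (e : C), 0 < e -> exists2 d : C, 0 < d &
  forall (t : C) E K K' (k : nat), 0 < t -> normal_resolvent dT t E K K' ->
    k%:R * t <= d -> `|y - iter k E y| <= e.
Proof.
move=> cT nT y e e0; have e4 : 0 < e / 4 by rewrite divr_gt0.
have e8 : 0 < e / 8 by rewrite divr_gt0.
have [y1 Ty1 yy1] : exists2 y1, opdom T y1 & `|y - y1| < e / 8.
  have [||y1 [yy1 Ty1]] := dT (ball y (e / 8)).
  - by exists y; apply: ballxx.
  - exact: (@ball_open C H).
  - by exists y1 => //; move: yy1; rewrite -ball_normE.
have [y2 [Ty2 Ty2' y12]] : exists y2, [/\ opdom T y2, opdom (adjoint dT) (T y2) & `|y1 - y2| <= e / 8].
  (* Chosen so that [resolvent_norm] gives an error of at most [e / 8]. *)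
  pose s := (e / 8) ^+ 2 / (`|T y1| ^+ 2 + 1).
  have n0 : 0 < `|T y1| ^+ 2 + 1 by rewrite ltr_wpDl ?exprn_ge0.
  have s0 : 0 < s by rewrite divr_gt0 ?exprn_gt0.
  have [y2 y2P] := resolvent_ex infC archC dT y1 s0 cT.
  exists y2; have [h1 h2 _] := y2P; split=> //.
  rewrite -(@ler_pXn2r _ 2)// ?nnegrE ?(ltW e8)//.
  apply: (le_trans (resolvent_norm s0 Ty1 y2P)).
  by rewrite /s mulrAC ler_pdivrMr// ler_wpM2l ?exprn_ge0 ?(ltW e8)// lerDl.
have {yy1 y12} yy2 : `|y - y2| <= e / 4.
  have -> : e / 4 = e / 8 + e / 8 by field.
  by rewrite (le_trans (ler_distD y1 _ _))// lerD// ltW.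
set z := adjoint dT (T y2); have n0 : 0 < `|z| + 1 by rewrite ltr_wpDl.
exists (e / 4 / (`|z| + 1)); first by rewrite divr_gt0.
move=> t E K K' k t0 [tr EP EP' EK EK'] kt.
have Ec := resolvent_triple_contract (ltW t0) tr.
have E2 : y2 - E y2 = t *: E z.
  have [_ _ e'] := EP y2; rewrite -[X in X - _]e' addrC addKr; congr (_ *: _).
  have [_ <- _] := EP' y2; rewrite -EK// -/z EK'//.
  by have [_ _ <-] := EP' (T y2).
have y2k : `|y2 - iter k E y2| <= e / 4.
  apply: le_trans (_ : k%:R * t * `|z| <= _).
    elim: k {kt} => [|k IH] /=; first by rewrite subrr normr0 !mul0r.
    have -> : y2 - E (iter k E y2) = (y2 - E y2) + E (y2 - iter k E y2).
      by rewrite linearB subrKA.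
    rewrite (le_trans (ler_normD _ _))// -natr1 mulrDl mulrDl mul1r addrC lerD//.
      by rewrite (le_trans (Ec _)).
    by rewrite E2 normrZ (gtr0_norm t0) ler_wpM2l ?(ltW t0).
  apply: le_trans (_ : k%:R * t * (`|z| + 1) <= _).
    by rewrite ler_wpM2l ?lerDl// mulr_ge0// ltW.
  by rewrite -ler_pdivlMr.
have -> : y - iter k E y = (y - y2) + (y2 - iter k E y2) - iter k E (y - y2).
  rewrite -[y in iter k E y](subrK y2) (iter_linearD E k (y - y2) y2).
  by rewrite subrKA opprD addrA addrAC.
have -> : e = e / 4 + e / 4 + e / 2 by field.
rewrite (le_trans (ler_normB _ _))// lerD//.
  by rewrite (le_trans (ler_normD _ _))// lerD.
rewrite (le_trans (iter_bound _ _ Ec))// (le_trans yy2)//.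
by rewrite ler_pM2l// lef_pV2 ?posrE// ler_nat.
Qed.

(** * From the intertwining relation to its adjoint form *)

Section Intertwining.
Context (T M : operator H) (dT : densely_defined T) (dM : densely_defined M)
  (A : {linear H -> H}) (c : C).
Context (c0 : 0 <= c) (Ac : forall v, `|A v| <= c * `|v|).
Context (AT : forall x, opdom T x -> opdom M (A x) /\ M (A x) = A (T x)).

(** Pairing with [y] lets the powers of [F] move to the right, so that the unbounded operators act
    on [x] and [y] alone. *)
Lemma intertwined_resolvent_bound (E K K' F G G' : {linear H -> H}) (r : C) n x y :
  0 < r -> normal_resolvent dT (r ^+ 2) E K K' ->
  normal_resolvent dM (r ^+ 2) F G G' ->
  opdom (adjoint dT) x -> opdom M y ->
  r * n.+1%:R * `|inner (A (iter (n.+1 + n.+1) E x)) (iter n.+1 F (M y)) -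
     inner (A (iter (n.+1 + n.+1) E (adjoint dT x))) (iter n.+1 F y)| <=
  c * `|x| * `|y|.
Proof.
move=> r0 [trE EP EP' EK EK'] [trF FP FP' FG FG'] Tx My.
have t0 : 0 <= r ^+ 2 by rewrite exprn_ge0// ltW.
have GAE v : G (A (E v)) = F (A (K v)).
  have [Ev _ _] := EP v; have [_ -> _] := EP' v.
  by have [h1 <-] := AT Ev; rewrite FG.
have [sF _ _ _ _] := trF.
have := intertwined_coef1_bound t0 n trE trF GAE c0 Ac r0 (erefl _) x.
move=> /(ler_wpM2r (normr_ge0 y)); apply: le_trans.
rewrite -[leRHS]mulrA ler_wpM2l ?mulr_ge0 ?(ltW r0)//.
have iE m : opdom (adjoint dT) (iter m E x) /\
    adjoint dT (iter m E x) = iter m E (adjoint dT x).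
  elim: m => // m [IH1 IH2]; rewrite !iterS; have [h1 _ h2] := EP' (iter m E x).
  by split=> //; rewrite -h2 -EK'// IH2.
have iF m : opdom M (iter m F y) /\ M (iter m F y) = iter m F (M y).
  elim: m => // m [IH1 IH2]; rewrite !iterS; have [h1 _ _] := FP (iter m F y).
  by have [_ h2 _] := FP' (iter m F y); split=> //; rewrite -h2 -FG// IH2.
have sFn m u v : inner (iter m F u) v = inner u (iter m F v).
  by elim: m u v => // m IH u v; rewrite [iter m.+1 F u]iterS [iter m.+1 F v]iterSr sF IH.
apply: le_trans (inner_leM _ _); rewrite innerBl !sFn -!iterD.
have -> : iter n E (K' (iter n.+1 E x)) = iter (n.+1 + n.+1) E (adjoint dT x).
  have [h1 h2] := iE n.+1.
  by rewrite -EK'// h2 -iterSr -iterD.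
set w := A (iter _ E x).
have -> // : inner (G' w) (iter n F y) = inner w (iter n.+1 F (M y)).
have [h1 h2] := iF n; have [h3 _ h4] := FP' w.
by rewrite h4 adjointPl// h2 sF.
Qed.

(** Weak form of the inclusion of [A T^*] in [M^* A], tested on the domain of [M]. *)
Lemma fuglede_putnam x y : closed_op T -> closed_op M ->
  op_eq (opcomp T (adjoint dT)) (opcomp (adjoint dT) T) ->
  op_eq (opcomp M (adjoint dM)) (opcomp (adjoint dM) M) ->
  opdom (adjoint dT) x -> opdom M y ->
  inner (A x) (M y) = inner (A (adjoint dT x)) y.
Proof.
move=> cT cM nT nM Tx My; apply/eqP; rewrite -subr_eq0; apply/eqP.
apply: small_eq0 => e e0; set x' := adjoint dT x; set y' := M y.
(* [Q] dominates [c] times all products of norms that occur; [d] allots a fifth of [e] to each of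
   five error terms. *)
pose Q := c * (`|x| + `|x'| + 1) * (`|y| + `|y'| + 1) + 1.
have X0 : 0 <= `|x| + `|x'| + 1 by rewrite !addr_ge0.
have Y0 : 0 <= `|y| + `|y'| + 1 by rewrite !addr_ge0.
have Q0 : 0 < Q by rewrite ltr_wpDl// !mulr_ge0.
pose d := e / (5 * Q); have d0 : 0 < d by rewrite divr_gt0// mulr_gt0.
have [d1 d10 P1] := resolvent_iter_cvg cT nT x d0.
have [d2 d20 P2] := resolvent_iter_cvg cT nT x' d0.
have [d3 d30 P3] := resolvent_iter_cvg cM nM y d0.
have [d4 d40 P4] := resolvent_iter_cvg cM nM y' d0.
have half (a : C) : 0 < a -> 0 < a / 2 by move=> a0; rewrite divr_gt0.
have [N0 H0] := archC d0.
have [N1 H1] := archC (half _ d10). have [N2 H2] := archC (half _ d20).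
have [N3 H3] := archC (half _ d30). have [N4 H4] := archC (half _ d40).
pose j := (N0 + N1 + N2 + N3 + N4)%N; pose m : C := j.+1%:R.
have m0 : 0 < m by rewrite ltr0n.
have m1 : 1 <= m by rewrite ler1n.
have mi0 : 0 <= m^-1 by rewrite invr_ge0 ltW.
have mi1 : m^-1 <= 1 by rewrite invf_le1.
(* With [n.+1 = m ^ 4], the product [r * n.+1 = m] is large while [n.+1 * r ^ 2 = m ^- 2] is
   small. *)
pose r := m ^- 3; have r0 : 0 < r by rewrite invr_gt0 exprn_gt0.
have [E [K [K' EP]]] := normal_resolvent_ex (exprn_gt0 2 r0) cT nT.
have [F [G [G' FP]]] := normal_resolvent_ex (exprn_gt0 2 r0) cM nM.
pose n := (j.+1 ^ 4).-1.
have nE : n.+1 = (j.+1 ^ 4)%N by rewrite prednK// expn_gt0.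
have nm : n.+1%:R = m ^+ 4 by rewrite nE natrX.
have k2 : (n.+1 + n.+1)%:R * r ^+ 2 <= 2 * m^-1.
  rewrite natrD nm /r.
  have -> : (m ^+ 4 + m ^+ 4) * m ^- 3 ^+ 2 = 2 * m^-1 * m^-1 by field; rewrite gt_eqF.
  by rewrite ler_piMr// mulr_ge0.
have k1 : n.+1%:R * r ^+ 2 <= 2 * m^-1.
  apply: le_trans k2; rewrite natrD mulrDl lerDl mulr_ge0//.
  by rewrite exprn_ge0// ltW.
have small (a : C) N : 0 < a -> (N <= j)%N ->
  (forall n, (N <= n)%N -> n.+1%:R^-1 < a / 2) -> 2 * m^-1 <= a.
  by move=> a0 Nj /(_ _ Nj); rewrite ltr_pdivlMr// mulrC => /ltW.
have le1 : (N1 <= j)%N by rewrite /j; clear; lia.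
have le2 : (N2 <= j)%N by rewrite /j; clear; lia.
have le3 : (N3 <= j)%N by rewrite /j; clear; lia.
have le4 : (N4 <= j)%N by rewrite /j; clear; lia.
have {}P1 := P1 _ _ _ _ (n.+1 + n.+1)%N (exprn_gt0 2 r0) EP (le_trans k2 (small _ _ d10 le1 H1)).
have {}P2 := P2 _ _ _ _ (n.+1 + n.+1)%N (exprn_gt0 2 r0) EP (le_trans k2 (small _ _ d20 le2 H2)).
have {}P3 := P3 _ _ _ _ n.+1 (exprn_gt0 2 r0) FP (le_trans k1 (small _ _ d30 le3 H3)).
have {}P4 := P4 _ _ _ _ n.+1 (exprn_gt0 2 r0) FP (le_trans k1 (small _ _ d40 le4 H4)).
have main := intertwined_resolvent_bound n r0 EP FP Tx My.
have EX u : `|iter (n.+1 + n.+1) E u| <= `|u|.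
  by apply: iter_bound; case: EP => /(resolvent_triple_contract (ltW (exprn_gt0 2 r0))).
have {EX} [X1 X2] := (EX x, EX x'); rewrite -/x' -/y' in main P1 P2 P3 P4.
move: X1 X2 P1 P2 P3 P4 main.
set X := iter _ E x; set X' := iter _ E x'; set Y := iter _ F y; set Y' := iter _ F y'.
move=> X1 X2 P1 P2 P3 P4 main.
have cQ u v : `|u| <= `|x| + `|x'| + 1 -> `|v| <= `|y| + `|y'| + 1 ->
    c * `|u| * `|v| <= Q.
  move=> hu hv; rewrite (@le_trans _ _ (Q - 1))//; last by rewrite gerBl.
  by rewrite /Q addrK ler_pM ?mulr_ge0// ler_wpM2l.
have x1 : `|x| <= `|x| + `|x'| + 1 by rewrite -addrA lerDl addr_ge0.
have x2 : `|x'| <= `|x| + `|x'| + 1 by rewrite addrAC lerDr addr_ge0.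
have y1 : `|y| <= `|y| + `|y'| + 1 by rewrite -addrA lerDl addr_ge0.
have y2 : `|y'| <= `|y| + `|y'| + 1 by rewrite addrAC lerDr addr_ge0.
have inA u v : `|inner (A u) v| <= c * `|u| * `|v|.
  by rewrite (le_trans (inner_leM _ _))// ler_wpM2r.
have cX : c * (`|x| + `|x'| + 1) <= Q.
  rewrite (@le_trans _ _ (Q - 1))//; last by rewrite gerBl.
  by rewrite /Q addrK ler_peMr ?mulr_ge0// lerDr addr_ge0.
have cY : c * (`|y| + `|y'| + 1) <= Q.
  rewrite (@le_trans _ _ (Q - 1))//; last by rewrite gerBl.
  by rewrite /Q addrK -mulrA ler_wpM2l// ler_peMl// lerDr addr_ge0.
have errl u v : `|u| <= d -> `|v| <= `|y| + `|y'| + 1 -> `|inner (A u) v| <= Q * d.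
  move=> ud vy; apply: le_trans (inA _ _) _; rewrite mulrAC ler_pM ?mulr_ge0//.
  by apply: le_trans cY; rewrite ler_wpM2l.
have errr u v : `|u| <= `|x| + `|x'| + 1 -> `|v| <= d -> `|inner (A u) v| <= Q * d.
  move=> ux vd; apply: le_trans (inA _ _) _; rewrite ler_pM ?mulr_ge0//.
  by apply: le_trans cX; rewrite ler_wpM2l.
have {}main : `|inner (A X) Y' - inner (A X') Y| <= Q * d.
  have rm : r * n.+1%:R = m by rewrite nm /r; field; rewrite gt_eqF.
  rewrite rm -ler_pdivlMl// in main; apply: (le_trans main).
  rewrite mulrC ler_pM ?mulr_ge0//; first exact: cQ.
  by rewrite ltW// H0// /j; clear; lia.
(* The first difference is controlled by [main]; the other four terms are the costs of regularising
   [x], [y'], [x'] and [y]. *)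
have -> : inner (A x) y' - inner (A x') y =
  inner (A X) Y' - inner (A X') Y + inner (A (x - X)) y' + inner (A X) (y' - Y')
   - inner (A (x' - X')) y - inner (A X') (y - Y).
  by rewrite !(linearB A) !innerBl !innerBr; ring.
have -> : e = Q * d + Q * d + Q * d + Q * d + Q * d.
  by rewrite /d; field; rewrite gt_eqF.
rewrite (le_trans (ler_normB _ _))// lerD//; last first.
  by apply: errr => //; exact: le_trans x2.
rewrite (le_trans (ler_normB _ _))// lerD//; last exact: errl.
rewrite (le_trans (ler_normD _ _))// lerD//; last first.
  by apply: errr => //; exact: le_trans x1.
by rewrite (le_trans (ler_normD _ _))// lerD//; exact: errl.
Qed.

End Intertwining.

End FugledePutnam.

(** * Bounded operators *)

Section BoundedOperators.
Context (C : numClosedFieldType) (infC : has_infima C)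
  (archC : archimedean_closed C) (H : hilbertType C).
Implicit Types (T M : operator H) (x y z u v w h k : H).

(** The constant in [bounded_op] can be any complex number when the space is trivial, so its modulus
    is used. *)
Lemma bounded_op_norm T : bounded_op T ->
  exists2 c : C, 0 <= c & forall x, `|T x| <= c * `|x|.
Proof.
move=> [_ [c Tc]]; exists `|c| => // x; apply: le_trans (Tc x) _.
have : 0 <= c * `|x| by exact: le_trans (Tc x).
by move=> /ger0_norm <-; rewrite normrM normr_id.
Qed.

Lemma bounded_opcomp_closed (B A : operator H) : closed_op B -> bounded_op A ->
  closed_op (opcomp B A).
Proof.
move=> /closed_opP cB bA; have [c c0 Ac] := bounded_op_norm bA.
have AT x : opdom A x by case: bA => ->.
apply/closed_opP => x y xy; suff [Bx ->] : opdom B (A x) /\ y = B (A x) by [].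
(* As [c + 1] exceeds [c] and is at least 1, the tolerance [e / (c + 1)] serves both coordinates. *)
apply: cB => e e0; have c1 : 0 < c + 1 by rewrite ltr_wpDl.
have e1 : 0 < e / (c + 1) by rewrite divr_gt0.
have [u [[_ Bu] xu yu]] := xy _ e1; exists (A u); split=> //.
  rewrite -opB//; apply: le_lt_trans (Ac _) _.
  apply: le_lt_trans (ler_wpM2l c0 (ltW xu)) _.
  by rewrite mulrCA gtr_pMr// ltr_pdivrMr// mul1r ltrDl.
by apply: lt_le_trans yu _; rewrite ler_pdivrMr// ler_peMr ?(ltW e0)// lerDr.
Qed.

(** For [e] with [f e] nonzero, projecting [(0, e)] onto the graph of the rank-one operator
    [x |-> f x *: e] gives a point [x] such that [inner u x] is a multiple of [f u]. *)
Lemma riesz (f : H -> C) (c : C) :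
  (forall (a : C) x y, f (a *: x + y) = a * f x + f y) ->
  0 <= c -> (forall x, `|f x| <= c * `|x|) -> exists z, forall x, f x = inner x z.
Proof.
move=> fl c0 fc; have [[e fe]|f0] := pselect (exists e, f e != 0); last first.
  exists 0 => x; rewrite inner0r; apply/eqP; apply: contrapT => /negP fx.
  by apply: f0; exists x.
have Tl (a : C) x y : [set: H] x -> [set: H] y ->
    f (a *: x + y) *: e = a *: (f x *: e) + f y *: e.
  by move=> _ _; rewrite fl scalerDl scalerA.
pose T := Operator (conj I (fun _ _ _ _ _ => I) : linear_subspace [set: H]) Tl.
have fB x y : f (x - y) = f x - f y.
  by rewrite addrC -scaleN1r fl mulN1r addrC.
have cT : closed_op T.
  apply/closed_opP => x y xy; split=> //; apply/eqP; rewrite -subr_eq0 -normr_eq0.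
  apply/eqP/small_eq0 => d d0; rewrite normr_id.
  pose Q := 1 + c * `|e|; have Q0 : 0 < Q by rewrite ltr_wpDr ?mulr_ge0.
  have [u [_ xu yu]] := xy _ (divr_gt0 d0 Q0).
  rewrite (le_trans (ler_distD (T u) _ _))//.
  have -> : d = d / Q + c * (d / Q) * `|e| by rewrite /Q; field; rewrite gt_eqF.
  rewrite lerD ?(ltW yu)//= -scalerBl -fB normrZ ler_wpM2r//.
  by apply: le_trans (fc _) _; rewrite ler_wpM2l// distrC ltW.
have [x _ xP] := graph_projection 0 e infC archC cT ltr01.
pose a := (1 - f x) * `|e| ^+ 2.
have xa u : inner u x = a^* * f u.
  have := xP u I; rewrite mul1r sub0r innerNl /= => /eqP.
  rewrite addrC subr_eq0 -[X in inner (X - _) _]scale1r -scalerBl innerZl innerZr.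
  move=> /eqP xu; rewrite innerC -xu !rmorphM/= conjCK -normr_inner mulrA mulrAC.
  by rewrite /a rmorphM.
have a0 : a != 0.
  apply/eqP => a0; have x0 : x = 0 by apply: inner_eq0; rewrite xa a0 conjC0 mul0r.
  have fx : f x = 0 by rewrite x0 -[0](subrr 0) fB subrr.
  move/eqP: a0; rewrite /a fx subr0 mul1r sqrf_eq0 normr_eq0 => /eqP e0.
  by move: fe; rewrite e0 -[0](subrr 0) fB subrr eqxx.
exists (a^-1 *: x) => u; rewrite innerZr xa fmorphV mulKf//.
by rewrite conjC_eq0.
Qed.

Lemma bounded_adjoint_total T (dT : densely_defined T) : bounded_op T ->
  forall y, opdom (adjoint dT) y.
Proof.
move=> bT y; have [c c0 Tc] := bounded_op_norm bT.
have TT x : opdom T x by case: bT => ->.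
have [|||z zP] := @riesz (fun x => inner (T x) y) (c * `|y|).
- by move=> a u v; rewrite op_linear// innerDl innerZl.
- exact: mulr_ge0.
- move=> x; rewrite (le_trans (inner_leM _ _))// mulrAC ler_wpM2r//.
by exists z => x _; exact: zP.
Qed.

End BoundedOperators.

(** * Normality of intertwined operators *)

Section Normality.
Context (C : numClosedFieldType) (infC : has_infima C)
  (archC : archimedean_closed C) (H : hilbertType C).
Context (T M : operator H) (dT : densely_defined T) (dM : densely_defined M)
  (A A' : {linear H -> H}).
Context (adjA : forall x y, inner (A x) y = inner x (A' y)).
Context (cT : closed_op T).
Context (nM : op_eq (opcomp M (adjoint dM)) (opcomp (adjoint dM) M)).
Context (AT : forall x, opdom T x -> opdom M (A x) /\ M (A x) = A (T x)).

(** Dual form of [fuglede_putnam]: it places [A' y] in the domain of [T^**], which is [T] by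
    closedness. *)
Lemma normal_intertwined y : closed_op M ->
  op_eq (opcomp T (adjoint dT)) (opcomp (adjoint dT) T) ->
  (exists2 c : C, 0 <= c & forall v, `|A v| <= c * `|v|) ->
  opdom M y -> opdom T (A' y) /\ T (A' y) = A' (M y).
Proof.
move=> cM nT [c c0 Ac] My; apply: (biadjoint infC archC cT (dT := dT)) => w Tw.
by rewrite -!adjA (fuglede_putnam infC archC c0 Ac AT cT cM nT nM Tw My).
Qed.

(* [A] maps both [(1 + T^*T)^-1 h] and [(1 + T T^* )^-1 h] to [(1 + M^*M)^-1 A h],
   and their difference is orthogonal to [ker A]. *)
Lemma normal_from_intertwining :
  (forall y, opdom M y -> opdom T (A' y) /\ T (A' y) = A' (M y)) ->
  (forall x, A x = 0 -> opdom T x /\ T x = 0) ->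
  (forall x u, A x = 0 -> opdom T u -> inner (T u) x = 0) ->
  op_eq (opcomp T (adjoint dT)) (opcomp (adjoint dT) T).
Proof.
move=> MA kerT kerT'.
have AT' x : opdom (adjoint dT) x ->
    opdom (adjoint dM) (A x) /\ adjoint dM (A x) = A (adjoint dT x).
  move=> Tx; apply: adjoint_intro => y My; have [h1 h2] := MA _ My.
  by rewrite innerC adjA -innerC -h2 adjointP// innerC -adjA -innerC.
have same h u w : resolvent_at dT 1 h u -> opdom (adjoint dT) w ->
    opdom T (adjoint dT w) -> w + T (adjoint dT w) = h -> u = w.
  move=> [Tu Tu' uh] Tw Tw' wh; rewrite scale1r in uh.
  have Auw : A u = A w.
    apply: (@resolvent_uniq _ _ M dM 1 (A h)); first exact: ltr01.
    - have [h1 h2] := AT Tu; have [h3 h4] := AT' _ Tu'.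
      by split; rewrite ?h2// h4 scale1r -uh linearD.
    - have [h1 h2] := AT' _ Tw; have [h3 h4] := AT Tw'.
      (* Normality of [M] turns [M M^* A w] into [M^* M A w], so [A w] solves the same resolvent
         equation as [A u]. *)
      have h5 : opcomp_dom M (adjoint dM) (A w) by split; rewrite ?h2.
      have [[/(_ _ h5) [h6 h7] /(_ _ h5) h8] _] := nM.
      split=> //; rewrite scale1r -[adjoint dM (M _)]h8 /=.
      by rewrite -[adjoint_fun M (A w)]/(adjoint dM (A w)) h2 h4 -wh linearD.
  have Ad : A (u - w) = 0 by rewrite linearB Auw subrr.
  have [Td Td0] := kerT _ Ad.
  (* Both terms on the right are orthogonal to [u - w], because [A (u - w) = 0] and the kernel of
     [A] lies in those of [T] and [T^*]. *)
  have dE : u - w = T (adjoint dT w) - adjoint dT (T u).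
    apply/eqP; rewrite subr_eq addrAC eq_sym subr_eq.
    by rewrite uh addrC wh.
  apply/eqP; rewrite -subr_eq0; apply/eqP/inner_eq0.
  by rewrite {1}dE innerBl kerT'// adjointPl// Td0 inner0r subrr.
(* Each [x] in one of the two domains is itself one of the two solutions for a suitable right-hand
   side, so [same] identifies it with the other solution. *)
split; split=> x [h1 h2].
- have [u uP] := resolvent_ex infC archC dT (x + T (adjoint dT x)) ltr01 cT.
  by have := same _ _ _ uP h1 h2 erefl; case: uP => ? ? _ <-.
- have [u uP] := resolvent_ex infC archC dT (x + T (adjoint dT x)) ltr01 cT.
  have ux := same _ _ _ uP h1 h2 erefl; move: uP; rewrite ux.
  by move=> [_ _]; rewrite scale1r => /addrI e; exact: esym e.
- have [w [w1 w2 w3]] := coresolvent_ex infC archC dT (x + adjoint dT (T x)) cT.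
  have xP : resolvent_at dT 1 (x + adjoint dT (T x)) x by split; rewrite ?scale1r.
  by rewrite (same _ _ _ xP w1 w2 w3).
- have [w [w1 w2 w3]] := coresolvent_ex infC archC dT (x + adjoint dT (T x)) cT.
  have xP : resolvent_at dT 1 (x + adjoint dT (T x)) x by split; rewrite ?scale1r.
  have xw := same _ _ _ xP w1 w2 w3; move: w3; rewrite -xw.
  by move=> /addrI e; exact: esym e.
Qed.

End Normality.

(** The normal extension [N] has the same kernel as [N^*], and [J] carries the resulting
    orthogonality back to [T]. *)
Lemma subnormal_kernel (C : numClosedFieldType) (H : hilbertType C) (T : operator H) x u :
  subnormal_op T -> opdom T x -> T x = 0 -> opdom T u -> inner (T u) x = 0.
Proof.
move=> [_ [K [J [N [iJ _ [dN [_ [_ nN]]] TN]]]]] Tx Tx0 Tu.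
have [NJx NJx0] := TN _ Tx; have [NJu NJuE] := TN _ Tu.
have h0 : opcomp_dom (adjoint dN) N (J x).
  by split=> //; rewrite -NJx0 Tx0 linear0; exact: opdom0.
have [/(_ _ h0) [h1 h2] /(_ _ h0) h3] := nN.
(* [|N^* J x|^2 = <N N^* J x, J x> = <N^* N J x, J x> = 0]. *)
have Z : adjoint dN (J x) = 0.
  apply: inner_eq0; rewrite -adjointP// -[N (adjoint dN (J x))]h3 /=.
  by rewrite -NJx0 Tx0 linear0 -[adjoint_fun N 0]/(adjoint dN 0) op0 inner0l.
by rewrite -iJ NJuE (adjointP NJu h1) Z inner0r.
Qed.

(** * Normality of [BA] for normal [A] and [AB] *)

Local Open Scope complex_scope.

Theorem theorem3p1 (R : realType) (H : hilbertType R[i]) (A B : operator H)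
    (sepH : separable H) (clB : closed_op B) (bdA : bounded_op A)
    (nAB : normal_op (opcomp A B)) (nA : normal_op A) :
  let Astar := adjoint (bounded_densely_defined bdA) in
  let AstarAB := opcomp Astar (opcomp A B) in
  let BAstarA := opcomp B (opcomp Astar A) in
  [/\ normal_op (opcomp B A) -> op_sub AstarAB BAstarA,
      hyponormal_op (opcomp B A) ->
        op_sub AstarAB BAstarA -> normal_op (opcomp B A) &
      subnormal_op (opcomp B A) ->
        op_sub AstarAB BAstarA -> normal_op (opcomp B A)].
Proof.
move=> Astar AstarAB BAstarA.
have infC := @complex_has_infima R; have archC := @complex_archimedean R.
have AT x : opdom A x by have [-> _] := bdA.
have AsT y : opdom Astar y by exact: bounded_adjoint_total.
have Alin : linear A by move=> a x y; rewrite op_linear.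
have Aslin : linear Astar by move=> a x y; rewrite op_linear.
pose P : {linear H -> H} :=
  HB.pack (A : H -> H) (GRing.isLinear.Build R[i] H H *:%R (A : H -> H) Alin).
pose P' : {linear H -> H} :=
  HB.pack (Astar : H -> H) (GRing.isLinear.Build R[i] H H *:%R (Astar : H -> H) Aslin).
have adjP x y : inner (P x) y = inner x (P' y) by exact: (adjointP (AT x) (AsT y)).
have PP' x : P (P' x) = P' (P x).
  by case: nA => dA [_ [[_ /(_ x (conj (AsT x) (AT _)))]]].
have bP := bounded_op_norm bdA.
have cT := bounded_opcomp_closed clB bdA.
have [dM [cM nM]] := nAB.
have intT x : opdom (opcomp B A) x ->
    opdom (opcomp A B) (P x) /\ opcomp A B (P x) = P (opcomp B A x).
  by move=> [].
(* Since [A] commutes with [A^*], the assumed inclusion says that [A^* M] is contained in [T A^*],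
   for [T = BA] and [M = AB]. *)
have MA : op_sub AstarAB BAstarA -> forall y, opdom (opcomp A B) y ->
    opdom (opcomp B A) (P' y) /\ opcomp B A (P' y) = P' (opcomp A B y).
  move=> [sub1 sub2] y My; have yM : opdom AstarAB y by split=> //; exact: AsT.
  have [_ h1] := sub1 _ yM; have h2 := sub2 _ yM.
  have PP'y : A (Astar y) = Astar (A y) by exact: PP'.
  split; first by split; [exact: AT|rewrite -[P' y]/(Astar y) PP'y].
  by rewrite -[RHS]/(AstarAB y) h2 -[LHS]/(B (A (Astar y))) PP'y.
have kerT x : P x = 0 -> opdom (opcomp B A) x /\ opcomp B A x = 0.
  move=> Px; have Ax : A x = 0 by exact: Px.
  split; first by split; [exact: AT|rewrite Ax; exact: opdom0].
  by rewrite /= Ax op0.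
split.
- move=> [dT [_ nT]].
  have MP y : opdom AstarAB y -> opdom BAstarA y /\ AstarAB y = BAstarA y.
    move=> [My _].
    have [[_ h1] h2] := normal_intertwined infC archC adjP cT nM intT cM nT bP My.
    have PP'y : A (Astar y) = Astar (A y) by exact: PP'.
    split; last by rewrite -[LHS]h2 -[LHS]/(B (A (Astar y))) PP'y.
    by split; [split; [exact: AT|exact: AsT]|rewrite -[opcomp Astar A y]PP'y].
  by split=> y /MP[].
- move=> [dT [hyp1 hypo]] sub; exists dT; split=> //.
  apply: (normal_from_intertwining infC archC dT adjP cT nM intT (MA sub) kerT).
  move=> x u Px Tu; have [Tx Tx0] := kerT _ Px.
  have [Tx' hx] := (hyp1 _ Tx, hypo _ Tx).
  (* Hyponormality bounds [T^* x] by [T x], which vanishes on the kernel of [A]. *)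
  have {}hx : adjoint dT x = 0.
    by apply/eqP; rewrite -normr_eq0 eq_le normr_ge0 andbT (le_trans hx)// Tx0 normr0.
  by rewrite (adjointP Tu Tx') hx inner0r.
- move=> subn sub; have [dT _] := subn; exists dT; split=> //.
  apply: (normal_from_intertwining infC archC dT adjP cT nM intT (MA sub) kerT).
  by move=> x u Px Tu; have [Tx Tx0] := kerT _ Px; exact: subnormal_kernel.
Qed.
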